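(* Let $m\ge 1$ and $n\ge m+1$ be integers. (i) Let $s$ be a real number with $0<s<m+1$. If $d$ generates an extreme ray of $SMET^{m,s}_n$, then its zero-extension $d^{ze}$ generates an extreme ray of $SMET^{m+1,s}_{n+1}$. (ii) If $d$ generates an extreme ray of $HMET^m_n$, then its vertex-splitting $d^{vs}$ generates an extreme ray of $HMET^m_{n+1}$.
   Context: Let $V_n=\{1,\dots,n\}$ and let $\binom{V_n}{m+1}$ be the set of $(m+1)$-subsets of $V_n$. For $d\in\mathbb{R}^{\binom{V_n}{m+1}}$, an $(m+2)$-subset $T\subset V_n$ and $i\in T$, the $(m,s)$-simplex inequality is $$s\, d(T\setminus\{i\})\le \sum_{k\in T\setminus\{i\}} d(T\setminus\{k\}),$$ and for an $(m+1)$-subset $A\subset V_n$ the non-negativity inequality is $d(A)\ge 0$. The cone $SMET^{m,s}_n\subset\mathbb{R}^{\binom{V_n}{m+1}}$ of $(m,s)$-super-metrics is the set of all $d$ satisfying all $(m,s)$-simplex inequalities and all non-negativity inequalities on $V_n$. The cone of $m$-hemi-metrics is $HMET^m_n=SMET^{m,1}_n$. An extreme ray of a polyhedral cone is a face of dimension $1$. Zero-extension: for a function $d$ on $\binom{V_n}{m+1}$, the function $d^{ze}$ on $\binom{V_{n+1}}{m+2}$ is defined by $d^{ze}(S)=0$ if $S\subset V_n$, and $d^{ze}(S)=d(S\cap V_n)$ otherwise. Vertex-splitting (of the vertex $n$ into $n$ and $n+1$): for a function $d$ on $\binom{V_n}{m+1}$, the function $d^{vs}$ on $\binom{V_{n+1}}{m+1}$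 is defined by $d^{vs}(S)=0$ if $\{n,n+1\}\subset S$; $d^{vs}(S)=d(S)$ if $S\subset V_n$; and $d^{vs}(S)=d\big((S\setminus\{n+1\})\cup\{n\}\big)$ if $n+1\in S$ and $n\notin S$. *)

(* Defs.v *)
From HB Require Import structures.
From mathcomp Require Import all_boot all_order all_algebra.
From mathcomp Require Import boolp classical_sets reals.

Set Implicit Arguments.
Unset Strict Implicit.
Unset Printing Implicit Defensive.

Import Order.TTheory GRing.Theory Num.Theory.

Local Open Scope classical_set_scope.
Local Open Scope ring_scope.

Section Faces.
Variables (R : realType) (V : vectType R).
Implicit Types (C F : set V) (d : V).

Definition is_face C F : Prop :=
  exists f : 'Hom(V, R^o),
    (forall x, C x -> (0 : R) <= f x) /\ F = C `&` [set x | f x = 0].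

(* U is the linear span of F.  A face of a cone contains 0, so its dimension
   is that of its linear span. *)
Definition is_span F (U : {vspace V}) : Prop :=
  (forall x, F x -> x \in U) /\
  (forall W : {vspace V}, (forall x, F x -> x \in W) -> (U <= W)%VS).

Definition has_dim F (k : nat) : Prop :=
  exists U : {vspace V}, is_span F U /\ \dim U = k.

Definition is_extreme_ray C F : Prop := is_face C F /\ has_dim F 1.

Definition ray d : set V := [set x | exists2 a : R, 0 <= a & x = a *: d].

Definition generates_extreme_ray C d : Prop := is_extreme_ray C (ray d).

End Faces.

(* The vertex set {1, ..., n} is 'I_n: vertex j is the ordinal of value j - 1. *)
Definition ksubset (n k : nat) := {A : {set 'I_n} | #|A| == k}.

(* Codomain R^o rather than R, to get the library's vector space structure. *)
Notation subset_fun R n k := {ffun ksubset n k -> R^o}.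

(* d(A) for a bare set A; the value 0 for #|A| != k is a default that none of
   the definitions below relies on. *)
Definition at_set (R : realType) n k (d : subset_fun R n k)
  (A : {set 'I_n}) : R := if insub A is Some B then d B else 0.

Section SuperMetrics.
Variable R : realType.

Definition simplex_ineq n m (s : R) (d : subset_fun R n m.+1)
    (T : {set 'I_n}) (i : 'I_n) : Prop :=
  s * at_set d (T :\ i) <= \sum_(k in T :\ i) at_set d (T :\ k).

Definition SMET n m (s : R) : set (subset_fun R n m.+1) :=
  [set d | (forall T : {set 'I_n}, #|T| = m.+2 ->
              forall i, i \in T -> simplex_ineq s d T i) /\
           (forall A : {set 'I_n}, #|A| = m.+1 -> 0 <= at_set d A)].

Arguments SMET : clear implicits.

Definition HMET n m : set (subset_fun R n m.+1) := SMET n m 1.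

End SuperMetrics.

Arguments SMET {R} n m s : rename.
Arguments HMET : clear implicits.

(* The intersection of S with V_n, where V_n sits in V_(n+1) as the complement
   of its last vertex ord_max. *)
Definition trace n (S : {set 'I_n.+1}) : {set 'I_n} :=
  [set i | widen_ord (leqnSn n) i \in S].

Definition zero_ext (R : realType) n m (d : subset_fun R n m.+1) :
    subset_fun R n.+1 m.+2 :=
  [ffun S : ksubset n.+1 m.+2 =>
     if ord_max \notin val S then 0 else at_set d (trace (val S))].

(* Vertex n of V_(n+1), for n > 0. *)
Definition split_vertex n : 'I_n.+1 := inord n.-1.

Definition vertex_split (R : realType) n m (d : subset_fun R n m.+1) :
    subset_fun R n.+1 m.+1 :=
  [ffun S : ksubset n.+1 m.+1 =>
     if (split_vertex n \in val S) && (ord_max \in val S) then 0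
     else if ord_max \notin val S then at_set d (trace (val S))
     else at_set d (trace (split_vertex n |: (val S :\ ord_max)))].

(* Main.v *)
Require Import Defs.
From HB Require Import structures.
From mathcomp Require Import all_boot all_order all_algebra.
From mathcomp Require Import boolp classical_sets reals.
From mathcomp Require Import zify lra.

Set Implicit Arguments.
Unset Strict Implicit.
Unset Printing Implicit Defensive.

Import Order.TTheory GRing.Theory Num.Theory.

Local Open Scope classical_set_scope.
Local Open Scope ring_scope.

(** For a polyhedral cone C, a vector d generates an extreme ray exactly when
    it is a nonzero element of C such that x + y = d with x, y in C forces x to
    be a nonnegative multiple of d (extreme_ray_indecomposable and
    indecomposable_extreme_ray).  The second description passes through linear
    embeddings: if E is injective, E y lies in C' exactly when y lies in C, and
    the part of C' in the image of E absorbs the summands in C' of its elements,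
    then E sends extreme rays of C to extreme rays of C'
    (extreme_ray_face_embedding).  Both parts are instances of this.

    Zero-extension.  For T containing the new vertex w, the simplex inequalities
    of zero_ext d at (T, i), i <> w, are those of d at (T minus w, i), since the
    additional term d^ze(T minus w) vanishes; all other simplex inequalities
    read 0 <= (a sum of nonnegative terms).  The image consists of the functions
    vanishing on the sets that avoid w.  If x + z is such a function and
    x, z >= 0, then so is x.

    Vertex-splitting.  Let v be the split vertex, w the new one, and merge the
    map sending w to v and fixing the rest; then d^vs(S) = d(merge S), where the
    right-hand side is 0 if merge collapses S.  On sets where merge is injective
    the simplex inequalities of d^vs and d correspond.  If T contains v and w,
    then d^vs(T minus k) is 0 unless k is v or w, and its values for k = v and
    k = w coincide, so the inequalities hold because s <= 1.
    Conversely, if a hemi-metric x vanishes on all sets containing both v and w,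
    then the simplex inequalities at (T, v) and (T, w) reduce, as s = 1,
    to x(T minus v) <= x(T minus w) and its reverse, so x takes equal values on
    sets exchanged by swapping v and w, hence is a vertex-splitting.  Vanishing
    on a family of sets again passes to nonnegative summands. *)

(** * Extreme rays of polyhedral cones *)

Section ExtremeRays.
Variables (R : realType) (V : vectType R).
Implicit Types (C : set V) (d x y : V).

Definition polyhedral C : Prop :=
  exists r : seq 'Hom(V, R^o),
    forall x, C x <-> (forall l, l \in r -> (0 : R) <= l x).

(** The usual geometric notion of an extreme direction.  Unlike that of an
    exposed face it mentions no functional, and so restricts to subcones. *)
Definition indecomposable C d : Prop :=
  [/\ C d, d != 0 & forall x y, C x -> C y -> x + y = d -> ray d x].

(** The functional exposing the ray vanishes at d = x + y and is nonnegative at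
    x and y, so it vanishes at x. *)
Lemma extreme_ray_indecomposable C d :
  generates_extreme_ray C d -> indecomposable C d.
Proof.
move=> [[f [f_ge0 rayE]] [U [[_ Umin] dimU]]].
have rayd : ray d d by exists 1; rewrite ?ler01 ?scale1r.
have [Cd fd0] : (C `&` [set x | f x = 0]) d by rewrite -rayE.
split=> //.
  apply/eqP => d0; have: (U <= 0)%VS.
    by apply: Umin => x [a _ ->]; rewrite d0 scaler0 mem0v.
  by rewrite subv0 -dimv_eq0 dimU.
move=> x y Cx Cy xyd; rewrite rayE; split=> //=.
have /eqP : f x + f y = 0 by rewrite -linearD xyd.
by rewrite paddr_eq0 ?f_ge0 // => /andP[/eqP].
Qed.

(** The sum of the constraints tight at d exposes the ray of d: if all of them
    vanish at x in C, then d - x / M stays in C for M large, because only the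
    constraints positive at d limit M; so x is a multiple of d. *)
Lemma indecomposable_extreme_ray C d :
  polyhedral C -> indecomposable C d -> generates_extreme_ray C d.
Proof.
move=> [r CE] [Cd dn0 indec].
have d_ge0 l : l \in r -> (0 : R) <= l d by move: l; apply/CE.
split; last first.
  exists <[d]>%VS; split; last by rewrite dim_vline dn0.
  split=> [x [a _ ->]|W sub]; first by rewrite memvZ ?memv_line.
  by rewrite -memvE; apply: sub; exists 1; rewrite ?ler01 ?scale1r.
exists (\sum_(l <- r | l d == 0) l); split.
  move=> x /CE x_ge0; rewrite sum_lfunE big_seq_cond sumr_ge0 // => l.
  by case/andP=> /x_ge0.
apply/seteqP; split=> x.
  move=> [a a_ge0 ->]; split=> /=.
    by apply/CE => l lr; rewrite linearZ mulr_ge0 ?d_ge0.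
  by rewrite sum_lfunE big1 // => l /eqP ld; rewrite linearZ /= ld scaler0.
move=> [/CE x_ge0] /=; rewrite sum_lfunE big_seq_cond.
move/eqP; rewrite psumr_eq0; last by move=> l /andP[/x_ge0].
move=> /allP tight.
(* This M satisfies l x <= M * l d for all constraints l with l d > 0; the 1
   makes M positive, and constraints with l d = 0 contribute 0. *)
pose M : R := 1 + \sum_(l <- r) l x / l d.
have sum_ge0 : 0 <= \sum_(l <- r) (l x : R) / l d.
  by rewrite big_seq sumr_ge0 // => l lr; rewrite divr_ge0 ?x_ge0 ?d_ge0.
have M_gt0 : 0 < M by rewrite /M; lra.
have Cx : C (M^-1 *: x).
  apply/CE => l lr; rewrite linearZ mulr_ge0 ?x_ge0 //.
  by rewrite invr_ge0 ltW.
have Cdx : C (d - M^-1 *: x).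
  apply/CE => l lr; rewrite linearB linearZ subr_ge0 /=.
  have [ld0|ldn0] := eqVneq (l d) 0.
    have /implyP := tight l lr; rewrite ld0 lr eqxx => /(_ isT) /eqP ->.
    by rewrite scaler0.
  have ld_gt0 : (0 : R) < l d by rewrite lt_def ldn0 d_ge0.
  rewrite -[_ *: _]/(M^-1 * (l x : R)) mulrC ler_pdivrMr // -ler_pdivrMl //.
  rewrite mulrC.
  apply: (@le_trans _ _ (\sum_(l <- r) (l x : R) / l d)); last by rewrite /M; lra.
  rewrite (big_rem l) //= lerDl big_seq sumr_ge0 // => l' /mem_rem l'r.
  by rewrite divr_ge0 ?x_ge0 ?d_ge0.
have [|a a_ge0 xE] := indec _ _ Cx Cdx; first by rewrite addrC subrK.
exists (M * a); first by rewrite mulr_ge0 // ltW.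
by rewrite -scalerA -xE scalerA divff ?scale1r // gt_eqF.
Qed.

End ExtremeRays.

(** The last hypothesis says that E meets C' in a face.  Both summands of
    E d in C' then come from summands of d in C. *)
Lemma extreme_ray_face_embedding (R : realType) (V V' : vectType R)
    (E : {linear V -> V'}) (C : set V) (C' : set V') :
  injective E -> polyhedral C' ->
  (forall y, C' (E y) <-> C y) ->
  (forall x z y, C' x -> C' z -> x + z = E y -> exists t, x = E t) ->
  forall d, generates_extreme_ray C d -> generates_extreme_ray C' (E d).
Proof.
move=> Einj polyC' CE face d /extreme_ray_indecomposable [Cd dn0 indec].
apply: indecomposable_extreme_ray => //; split; first exact/CE.
  by rewrite -(inj_eq Einj) linear0 in dn0.
move=> x z C'x C'z xz; have [t xE] := face x z d C'x C'z xz.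
have zE : z = E (d - t) by rewrite linearB -xz xE addrC addKr.
rewrite xE in C'x *; rewrite zE in C'z.
have [|||a a_ge0 ->] := indec t (d - t); [exact/CE|exact/CE| |].
  by rewrite addrC subrK.
by exists a; rewrite ?linearZ.
Qed.

(** * Values at sets and simplex inequalities *)

Section AtSet.
Variables (R : realType) (n k : nat).
Implicit Types (d : subset_fun R n k) (A : {set 'I_n}).

Lemma at_set_val d (B : ksubset n k) : at_set d (val B) = d B.
Proof. by rewrite /at_set valK. Qed.

Lemma at_set_default d A : #|A| != k -> at_set d A = 0.
Proof. by move=> cA; rewrite /at_set insubN. Qed.

Lemma at_set_ext d d' :
  (forall A, #|A| = k -> at_set d A = at_set d' A) -> d = d'.
Proof.
move=> eq_dd'; apply/ffunP => B; rewrite -!at_set_val.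
by apply/eq_dd'/eqP/(valP B).
Qed.

Lemma at_setE d A (cA : #|A| == k) : at_set d A = d (exist _ A cA).
Proof. by rewrite -at_set_val. Qed.

Lemma at_set_combination a d d' A :
  at_set (a *: d + d') A = a * at_set d A + at_set d' A.
Proof.
rewrite /at_set; case: insubP => [B _ _|_]; first by rewrite !ffunE.
by rewrite mulr0 addr0.
Qed.

Lemma at_setD d d' A : at_set (d + d') A = at_set d A + at_set d' A.
Proof. by rewrite -[d]scale1r at_set_combination mul1r scale1r. Qed.

(** With codomain R^o, a vector space over R, so that linearity makes sense. *)
Definition evaluation A d : R^o := at_set d A.

Lemma evaluation_linear A : linear (evaluation A).
Proof. by move=> a d d'; apply: at_set_combination. Qed.

HB.instance Definition _ A :=
  GRing.isLinear.Build R (subset_fun R n k) R^o *:%R (evaluation A)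
    (evaluation_linear A).

Definition at_form A : 'Hom(subset_fun R n k, R^o) := linfun (evaluation A).

Lemma at_formE A d : at_form A d = at_set d A.
Proof. by rewrite lfunE. Qed.

End AtSet.

Lemma SMET_polyhedral (R : realType) n m (s : R) :
  polyhedral (SMET n m s).
Proof.
pose simplex_form (p : {set 'I_n} * 'I_n) : 'Hom(subset_fun R n m.+1, R^o) :=
  \sum_(k in p.1 :\ p.2) at_form R m.+1 (p.1 :\ k)
    - s *: at_form R m.+1 (p.1 :\ p.2).
exists ([seq simplex_form p | p <- enum [pred p : {set 'I_n} * 'I_n |
                                   (#|p.1| == m.+2) && (p.2 \in p.1)]]
        ++ [seq at_form R m.+1 A | A <- enum [pred A : {set 'I_n} | #|A| == m.+1]]).
have formE d T i : (0 : R) <= simplex_form (T, i) d <-> simplex_ineq s d T i.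
  rewrite /simplex_form /simplex_ineq add_lfunE opp_lfunE scale_lfunE sum_lfunE.
  rewrite at_formE subr_ge0.
  by under eq_bigr do rewrite at_formE.
move=> d; split=> [[ineq d_ge0] l|d_ge0].
  rewrite mem_cat => /orP[] /mapP [].
    case=> T i; rewrite mem_enum inE /= => /andP[/eqP cT iT] ->.
    exact/formE/ineq.
  by move=> A; rewrite mem_enum inE => /eqP cA ->; rewrite at_formE d_ge0.
split=> [T cT i iT|A cA].
  apply/formE/d_ge0; rewrite mem_cat map_f // mem_enum inE /=.
  by rewrite cT eqxx.
rewrite -at_formE d_ge0 // mem_cat orbC map_f // mem_enum inE.
exact/eqP.
Qed.

Section SimplexIneq.
Variables (R : realType) (n m : nat) (s : R) (d : subset_fun R n m.+1).
Variables (T : {set 'I_n}) (i k : 'I_n).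
Hypothesis kTi : k \in T :\ i.

Lemma simplex_ineq_of_term :
  (forall l, l \in T :\ i -> 0 <= at_set d (T :\ l)) ->
  s * at_set d (T :\ i) <= at_set d (T :\ k) -> simplex_ineq s d T i.
Proof.
move=> ge0 le_ik; apply: le_trans le_ik _.
rewrite (big_setD1 k) //= lerDl sumr_ge0 // => l /setD1P[_]; exact: ge0.
Qed.

Lemma simplex_ineq_one_term :
  (forall l, l \in T :\ i -> l != k -> at_set d (T :\ l) = 0) ->
  simplex_ineq s d T i -> s * at_set d (T :\ i) <= at_set d (T :\ k).
Proof.
move=> eq0; rewrite /simplex_ineq (big_setD1 k) //= big1 ?addr0 // => l.
by case/setD1P=> lk lTi; rewrite eq0.
Qed.

End SimplexIneq.

(** * Sets of vertices after adding a vertex *)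

Section AddVertex.
Variable n : nat.
Implicit Types (S T : {set 'I_n.+1}) (A : {set 'I_n}).

Definition old (i : 'I_n) : 'I_n.+1 := widen_ord (leqnSn n) i.

Lemma old_inj : injective old.
Proof. by move=> i j /(congr1 val) /= /val_inj. Qed.

Lemma old_neq_max i : (old i == ord_max) = false.
Proof. by apply/negbTE; rewrite -val_eqE /= neq_ltn ltn_ord. Qed.

Variant vertex_spec : 'I_n.+1 -> Type :=
  | NewVertex : vertex_spec ord_max
  | OldVertex i : vertex_spec (old i).

Lemma vertexP i : vertex_spec i.
Proof.
case: (unliftP ord_max i) => [j ->|->]; last exact: NewVertex.
suff -> : lift ord_max j = old j by exact: OldVertex.
by apply: val_inj; exact: lift_max.
Qed.

Lemma in_trace S i : (i \in trace S) = (old i \in S).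
Proof. by rewrite inE. Qed.

Lemma big_trace (M : Type) (idx : M) (op : Monoid.law idx) S F :
  \big[op/idx]_(k in S) F k =
  op (\big[op/idx]_(k in trace S) F (old k))
     (if ord_max \in S then F ord_max else idx).
Proof.
rewrite big_mkcond big_ord_recr -big_mkcond /=; congr (op _ _).
by apply: eq_bigl => i; rewrite inE.
Qed.

Lemma card_trace S : #|S| = (#|trace S| + (ord_max \in S))%N.
Proof. by rewrite -!sum1_card big_trace; case: ifP. Qed.

Lemma traceD1_old S i : trace (S :\ old i) = trace S :\ i.
Proof. by apply/setP => j; rewrite !inE (inj_eq old_inj). Qed.

Lemma traceD1_max S : trace (S :\ ord_max) = trace S.
Proof. by apply/setP => j; rewrite !inE -[widen_ord _ _]/(old _) old_neq_max. Qed.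

Definition cone_set A : {set 'I_n.+1} := ord_max |: old @: A.

Lemma max_in_cone A : ord_max \in cone_set A.
Proof. by rewrite !inE eqxx. Qed.

Lemma trace_cone A : trace (cone_set A) = A.
Proof.
apply/setP => i; rewrite in_trace !inE old_neq_max.
by rewrite (mem_imset _ _ old_inj).
Qed.

Lemma cone_trace S : ord_max \in S -> cone_set (trace S) = S.
Proof.
move=> mS; apply/setP => i; case: (vertexP i) => [|j]; first by rewrite max_in_cone.
by rewrite -!in_trace trace_cone.
Qed.

Lemma card_cone A : #|cone_set A| = #|A|.+1.
Proof. by rewrite card_trace trace_cone max_in_cone addn1. Qed.

End AddVertex.

(** * Zero-extension *)

Section ZeroExtension.
Variables (R : realType) (n m : nat).
Implicit Types (d : subset_fun R n m.+1) (x : subset_fun R n.+1 m.+2).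
Implicit Types (S T : {set 'I_n.+1}) (A : {set 'I_n}).

Lemma at_zero_ext d S :
  at_set (zero_ext d) S = if ord_max \in S then at_set d (trace S) else 0.
Proof.
have [cS|cS] := boolP (#|S| == m.+2).
  by rewrite (at_setE _ cS) ffunE /=; case: (_ \in _).
rewrite at_set_default //; case: ifP => // mS; rewrite at_set_default //.
by apply: contra cS => /eqP cS; rewrite card_trace cS mS addn1.
Qed.

Lemma zero_ext_linear : linear (@zero_ext R n m).
Proof.
move=> a d d'; apply/ffunP => S; rewrite !ffunE.
case: ifP => _; first by rewrite scaler0 addr0.
exact: at_set_combination.
Qed.

HB.instance Definition _ :=
  GRing.isLinear.Build R (subset_fun R n m.+1) (subset_fun R n.+1 m.+2) *:%R
    (@zero_ext R n m) zero_ext_linear.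

Lemma at_zero_ext_cone d A : at_set (zero_ext d) (cone_set A) = at_set d A.
Proof. by rewrite at_zero_ext max_in_cone trace_cone. Qed.

Lemma zero_ext_inj : injective (@zero_ext R n m).
Proof.
by move=> d d' E; apply: at_set_ext => A _; rewrite -!at_zero_ext_cone E.
Qed.

(** Removing the new vertex gives the only term of the sum that is not a term of
    the inequality for d, and it vanishes. *)
Lemma zero_ext_simplex_ineq (s : R) d T j : ord_max \in T ->
  simplex_ineq s (zero_ext d) T (old j) <-> simplex_ineq s d (trace T) j.
Proof.
move=> mT; have mTD k : ord_max \in T :\ old k.
  by rewrite !inE mT eq_sym old_neq_max.
have atE k : at_set (zero_ext d) (T :\ old k) = at_set d (trace T :\ k).
  by rewrite at_zero_ext mTD traceD1_old.
have at_max : at_set (zero_ext d) (T :\ ord_max) = 0.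
  by rewrite at_zero_ext setD11.
rewrite /simplex_ineq big_trace /= mTD at_max addr0 traceD1_old atE.
by under eq_bigr do rewrite atE.
Qed.

(** The inequalities not inherited from d have left-hand side 0: there the set
    T minus i avoids the new vertex. *)
Lemma SMET_zero_ext (s : R) d :
  SMET n.+1 m.+1 s (zero_ext d) <-> SMET n m s d.
Proof.
split=> [[ineq ge0]|[ineq ge0]].
  split=> [T cT j jT|A cA].
    rewrite -(trace_cone T) -zero_ext_simplex_ineq ?max_in_cone //.
    by apply: ineq; rewrite ?card_cone ?cT // -in_trace trace_cone.
  by rewrite -at_zero_ext_cone ge0 // card_cone cA.
have ze_ge0 S : #|S| = m.+2 -> 0 <= at_set (zero_ext d) S.
  rewrite at_zero_ext card_trace; case: (_ \in _) => // /eqP.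
  by rewrite addn1 eqSS => /eqP /ge0.
split=> // T cT i iT.
have cTD k : k \in T -> #|T :\ k| = m.+2.
  by move=> kT; move: cT; rewrite (cardsD1 k) kT => -[].
have sum_ge0 : 0 <= \sum_(k in T :\ i) at_set (zero_ext d) (T :\ k).
  by apply: sumr_ge0 => k /setD1P[_ kT]; rewrite ze_ge0 ?cTD.
have [mT|mT] := boolP (ord_max \in T).
  move: iT sum_ge0; case: (vertexP i) => [_|j jT _].
    by rewrite /simplex_ineq at_zero_ext setD11 mulr0.
  apply/zero_ext_simplex_ineq => //; apply: ineq; last by rewrite in_trace.
  by move: cT; rewrite card_trace mT addn1 => -[].
by rewrite /simplex_ineq at_zero_ext !inE (negbTE mT) andbF mulr0.
Qed.

Lemma zero_ext_image x :
  (forall S, #|S| = m.+2 -> ord_max \notin S -> at_set x S = 0) ->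
  exists d, x = zero_ext d.
Proof.
move=> x0; exists [ffun A : ksubset n m.+1 => at_set x (cone_set (val A))].
apply: at_set_ext => S cS; rewrite at_zero_ext; case: ifPn => mS; last exact: x0.
have ctrS : #|trace S| == m.+1.
  by move: cS; rewrite card_trace mS addn1 => -[->].
by rewrite (at_setE _ ctrS) ffunE /= cone_trace.
Qed.

(** The nonnegative x and z have sum 0 on the sets without the new vertex. *)
Lemma zero_ext_face (s : R) x z d :
  SMET n.+1 m.+1 s x -> SMET n.+1 m.+1 s z -> x + z = zero_ext d ->
  exists t, x = zero_ext t.
Proof.
move=> [_ x_ge0] [_ z_ge0] xz; apply: zero_ext_image => S cS mS.
have /eqP : at_set x S + at_set z S = 0.
  by rewrite -at_setD xz at_zero_ext (negbTE mS).
by rewrite paddr_eq0 ?x_ge0 ?z_ge0 // => /andP[/eqP].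
Qed.

End ZeroExtension.

(** * Vertex-splitting *)

Section VertexSplitting.
Variables (R : realType) (n m : nat).
Implicit Types (d : subset_fun R n.+1 m.+1) (x : subset_fun R n.+2 m.+1).
Implicit Types (S T : {set 'I_n.+2}) (A : {set 'I_n.+1}).

Let twin : 'I_n.+2 := old ord_max.

(** The retraction identifying the new vertex, of value n + 1, with the split
    one, of value n; vertex-splitting is composition with it. *)
Definition merge (i : 'I_n.+2) : 'I_n.+1 := inord (minn i n).

Lemma val_merge i : merge i = minn i n :> nat.
Proof. by rewrite inordK // ltnS geq_minr. Qed.

Lemma merge_old i : merge (old i) = i.
Proof. by apply: ord_inj; have := ltn_ord i; rewrite val_merge /=; lia. Qed.

Lemma merge_max : merge ord_max = ord_max.
Proof. by apply: ord_inj; rewrite val_merge /=; lia. Qed.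

Lemma max_neq_twin : (ord_max == twin) = false.
Proof. by rewrite eq_sym old_neq_max. Qed.

Lemma merge_imset S :
  merge @: S = if ord_max \in S then ord_max |: trace S else trace S.
Proof.
apply/setP => i; apply/imsetP/idP => [[k kS ->{i}]|].
  move: kS; case: (vertexP k) => [mS|j jS].
    by rewrite mS merge_max !inE eqxx.
  by rewrite merge_old; case: ifP; rewrite !inE ?jS ?orbT.
have trS : i \in trace S -> exists2 k, k \in S & i = merge k.
  by rewrite in_trace => iS; exists (old i); rewrite ?merge_old.
case: ifP => // mS /setU1P[->|//].
by exists ord_max; rewrite ?merge_max.
Qed.

Lemma merge_in_inj S : ~~ ((twin \in S) && (ord_max \in S)) ->
  {in S &, injective merge}.
Proof.
move=> nS i j; case: (vertexP i) => [|k]; case: (vertexP j) => [|l] //.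
- rewrite merge_max merge_old => mS lS lE.
  by case/andP: nS; rewrite /twin lE.
- rewrite merge_max merge_old => kS mS kE.
  by case/andP: nS; rewrite /twin -kE.
- by rewrite !merge_old => _ _ ->.
Qed.

Lemma card_merge_twins S : twin \in S -> ord_max \in S ->
  #|S| = #|merge @: S|.+1.
Proof.
move=> tS mS; rewrite merge_imset mS card_trace mS addn1 cardsU1.
by rewrite in_trace -/twin tS.
Qed.

Lemma split_vertexE : split_vertex n.+1 = twin.
Proof. by apply: val_inj; rewrite /= inordK. Qed.

(** This one formula covers all three cases of the definition: if S contains
    both twins, its image has only m elements, and at_set is 0 there. *)
Lemma at_vertex_split d S : #|S| = m.+1 ->
  at_set (vertex_split d) S = at_set d (merge @: S).
Proof.
move=> /[dup] cS /eqP cS'; rewrite (at_setE _ cS') ffunE /= split_vertexE.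
case: ifPn => [/andP[tS mS]|_].
  by rewrite at_set_default // -eqSS -(card_merge_twins tS mS) cS ltn_eqF.
rewrite merge_imset; case: (ord_max \in S) => //=.
congr at_set; apply/setP => i; rewrite in_trace !inE old_neq_max /=.
by rewrite (inj_eq (@old_inj _)).
Qed.

Lemma vertex_split_linear : linear (@vertex_split R n.+1 m).
Proof.
move=> a d d'; apply/ffunP => S; rewrite !ffunE.
case: ifP => _; first by rewrite scaler0 addr0.
by case: ifP => _; apply: at_set_combination.
Qed.

HB.instance Definition _ :=
  GRing.isLinear.Build R (subset_fun R n.+1 m.+1) (subset_fun R n.+2 m.+1) *:%R
    (@vertex_split R n.+1 m) vertex_split_linear.

Lemma merge_old_imset A : merge @: (@old n.+1 @: A) = A.
Proof.
rewrite -imset_comp -[RHS]imset_id.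
by apply: eq_imset => i; exact: merge_old.
Qed.

Lemma at_vertex_split_old d A : #|A| = m.+1 ->
  at_set (vertex_split d) (@old n.+1 @: A) = at_set d A.
Proof.
move=> cA; rewrite at_vertex_split ?merge_old_imset //.
by rewrite card_imset //; exact: old_inj.
Qed.

Lemma vertex_split_inj : injective (@vertex_split R n.+1 m).
Proof.
move=> d d' E; apply: at_set_ext => A cA.
by rewrite -!at_vertex_split_old // E.
Qed.

Lemma merge_imsetD1 T i : {in T &, injective merge} -> i \in T ->
  merge @: (T :\ i) = (merge @: T) :\ merge i.
Proof.
move=> injT iT; apply/setP => j; apply/imsetP/setD1P => [[k /setD1P[ki kT] ->]|].
  split; last exact: imset_f.
  by apply: contra ki => /eqP E; rewrite (injT k i kT iT E).
move=> [ji /imsetP[k kT jE]]; exists k => //; rewrite inE kT andbT inE.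
by apply: contra ji => /eqP <-; rewrite jE.
Qed.

Lemma vertex_split_simplex_ineq (s : R) d T i :
  {in T &, injective merge} -> #|T| = m.+2 -> i \in T ->
  simplex_ineq s (vertex_split d) T i <->
  simplex_ineq s d (merge @: T) (merge i).
Proof.
move=> injT cT iT.
have atE k : k \in T ->
    at_set (vertex_split d) (T :\ k) = at_set d ((merge @: T) :\ merge k).
  move=> kT; rewrite at_vertex_split ?merge_imsetD1 //.
  by move: cT; rewrite (cardsD1 k) kT => -[].
rewrite /simplex_ineq atE // -merge_imsetD1 // big_imset /=; last first.
  by move=> k l /setD1P[_ kT] /setD1P[_ lT]; apply: injT.
by under eq_bigr => k /setD1P[_ kT] do rewrite atE //.
Qed.

Lemma vertex_split_twins d S : #|S| = m.+1 -> twin \in S -> ord_max \in S ->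
  at_set (vertex_split d) S = 0.
Proof.
move=> cS tS mS; rewrite at_vertex_split // at_set_default //.
by rewrite -eqSS -(card_merge_twins tS mS) cS ltn_eqF.
Qed.

(** Only the sets T containing both twins give inequalities not inherited
    from d.  There the values at T minus either twin agree and the other terms
    vanish, so one term of the sum already bounds the left-hand side. *)
Lemma HMET_vertex_split d :
  HMET R n.+2 m (vertex_split d) <-> HMET R n.+1 m d.
Proof.
split=> [[ineq ge0]|[ineq ge0]].
  split=> [T cT i iT|A cA]; last first.
    rewrite -at_vertex_split_old // ge0 //.
    by rewrite card_imset //; exact: old_inj.
  have inj_merge : {in @old n.+1 @: T &, injective merge}.
    move=> _ _ /imsetP[k _ ->] /imsetP[l _ ->].
    by rewrite !merge_old => ->.
  have coT : #|@old n.+1 @: T| = m.+2 by rewrite card_imset //; exact: old_inj.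
  have ioT : old i \in @old n.+1 @: T by apply: imset_f.
  have := ineq _ coT _ ioT.
  move/(vertex_split_simplex_ineq _ _ inj_merge coT ioT).
  by rewrite merge_old_imset merge_old.
have vs_ge0 S : #|S| = m.+1 -> 0 <= at_set (vertex_split d) S.
  move=> cS; rewrite at_vertex_split //.
  have [cA|cA] := eqVneq #|merge @: S| m.+1; first exact: ge0.
  by rewrite at_set_default.
split=> // T cT i iT.
have [/andP[tT mT]|/merge_in_inj inj_merge] :=
  boolP ((twin \in T) && (ord_max \in T)); last first.
  apply/vertex_split_simplex_ineq => //.
  by apply: ineq; rewrite ?imset_f // card_in_imset.
have cTD k : k \in T -> #|T :\ k| = m.+1.
  by move=> kT; move: cT; rewrite (cardsD1 k) kT => -[].
have term_ge0 k : k \in T :\ i -> 0 <= at_set (vertex_split d) (T :\ k).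
  by case/setD1P=> _ kT; rewrite vs_ge0 ?cTD.
have twin_term : at_set (vertex_split d) (T :\ twin) =
                 at_set (vertex_split d) (T :\ ord_max).
  rewrite !at_vertex_split ?cTD // !merge_imset setD11 !inE max_neq_twin mT /=.
  by rewrite traceD1_old traceD1_max finset.setD1K // in_trace.
have [k kTi le_ik] : exists2 k, k \in T :\ i &
    at_set (vertex_split d) (T :\ i) <= at_set (vertex_split d) (T :\ k).
  have [->|i_twin] := eqVneq i twin.
    by exists ord_max; rewrite ?twin_term // !inE max_neq_twin.
  exists twin; first by rewrite !inE eq_sym i_twin.
  have [->|i_max] := eqVneq i ord_max; first by rewrite twin_term.
  rewrite vertex_split_twins ?cTD // ?vs_ge0 ?cTD //.
    by rewrite !inE eq_sym i_twin.
  by rewrite !inE eq_sym i_max.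
by apply: (simplex_ineq_of_term kTi term_ge0); rewrite mul1r.
Qed.

(** The simplex inequalities of x at each of the twins give the two inequalities
    between the values of x at sets that differ by exchanging the twins. *)
Lemma vertex_split_image x : HMET R n.+2 m x ->
  (forall S, #|S| = m.+1 -> twin \in S -> ord_max \in S -> at_set x S = 0) ->
  exists d, x = vertex_split d.
Proof.
move=> [ineq _] x0.
exists [ffun A : ksubset n.+1 m.+1 => at_set x (@old n.+1 @: val A)].
apply: at_set_ext => S cS.
have [/andP[tS mS]|nS] := boolP ((twin \in S) && (ord_max \in S)).
  by rewrite vertex_split_twins ?x0.
have cA : #|merge @: S| == m.+1.
  by rewrite card_in_imset ?cS //; exact: merge_in_inj.
rewrite at_vertex_split // (at_setE _ cA) ffunE /= merge_imset.
have [mS|mS] := boolP (ord_max \in S); last first.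
  congr at_set; apply/setP => i; case: (vertexP i) => [|j].
    rewrite (negbTE mS); apply/esym/negP => /imsetP[j _ /eqP].
    by rewrite eq_sym old_neq_max.
  by rewrite (mem_imset _ _ (@old_inj _)) in_trace.
(* S has the new vertex but not its twin: compare S with the set S' where the
   twin replaces the new vertex, inside T, the union of the two. *)
have tS : twin \notin S by move: nS; rewrite mS andbT.
pose T := twin |: S.
have cT : #|T| = m.+2 by rewrite cardsU1 tS cS.
have tT : twin \in T by rewrite setU11.
have mT : ord_max \in T by rewrite setU1r.
have cTD k : k \in T -> #|T :\ k| = m.+1.
  by move=> kT; move: cT; rewrite (cardsD1 k) kT => -[].
have SE : S = T :\ twin by rewrite setU1K.
have S'E : @old n.+1 @: (ord_max |: trace S) = T :\ ord_max.
  apply/setP => i; case: (vertexP i) => [|j].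
    rewrite setD11; apply/negP => /imsetP[j _ /eqP].
    by rewrite eq_sym old_neq_max.
  rewrite (mem_imset _ _ (@old_inj _)) !inE old_neq_max /=.
  by rewrite (inj_eq (@old_inj _)).
have T0 l : l \in T -> l != twin -> l != ord_max -> at_set x (T :\ l) = 0.
  move=> lT lt lm; rewrite x0 ?cTD // !inE eq_sym ?lt ?lm ?eqxx //.
  by rewrite mS orbT.
rewrite S'E [in LHS]SE; apply/le_anti/andP; split.
  rewrite -[X in X <= _]mul1r.
  apply: simplex_ineq_one_term (ineq T cT _ tT).
    by rewrite !inE max_neq_twin mS orbT.
  by move=> l /setD1P[lt lT] lm; apply: T0.
rewrite -[X in X <= _]mul1r.
apply: simplex_ineq_one_term (ineq T cT _ mT).
  by rewrite !inE old_neq_max eqxx.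
by move=> l /setD1P[lm lT] lt; apply: T0.
Qed.

(** The nonnegative x and z have sum 0 on the sets containing both twins. *)
Lemma vertex_split_face x z d :
  HMET R n.+2 m x -> HMET R n.+2 m z -> x + z = vertex_split d ->
  exists t, x = vertex_split t.
Proof.
move=> Cx Cz xz; apply: vertex_split_image => // S cS tS mS.
have /eqP : at_set x S + at_set z S = 0.
  by rewrite -at_setD xz vertex_split_twins.
by case: Cx Cz => _ x0 [_ z0]; rewrite paddr_eq0 ?x0 ?z0 // => /andP[/eqP].
Qed.

End VertexSplitting.

(** * Extreme rays under both constructions *)

Theorem theorem2 (R : realType) (m n : nat)
    (hm : (1 <= m)%N) (hn : (m.+1 <= n)%N) :
  (forall s : R, 0 < s -> s < m.+1%:R ->
     forall d : subset_fun R n m.+1,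
       generates_extreme_ray (SMET n m s) d ->
       generates_extreme_ray (SMET n.+1 m.+1 s) (zero_ext d)) /\
  (forall d : subset_fun R n m.+1,
     generates_extreme_ray (HMET R n m) d ->
     generates_extreme_ray (HMET R n.+1 m) (vertex_split d)).
Proof.
split=> [s _ _|].
  apply: extreme_ray_face_embedding; first exact: zero_ext_inj.
  - exact: SMET_polyhedral.
  - exact: SMET_zero_ext.
  - exact: zero_ext_face.
case: n hn => // n _.
apply: extreme_ray_face_embedding; first exact: vertex_split_inj.
- exact: SMET_polyhedral.
- exact: HMET_vertex_split.
- exact: vertex_split_face.
Qed.
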